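(* Let $X,Y,A,B$ be non-empty finite sets. Then $\mathcal O^{\mathcal R_{\rm loc}}_{XY,AB}=\mathcal S_1^{A,X}\otimes_{w,{\rm cb}}\mathcal S_1^{B,Y}$ up to a complete isometry (under the identification $\epsilon_{(x,y),(a,b)}\leftrightarrow\epsilon_{x,a}\otimes\epsilon_{y,b}$).
   Context: $\mathcal S_1^{A,X}$ is the space of operators $\mathbb C^A\to\mathbb C^X$ (matrix units $\epsilon_{x,a}=e_xe_a^*$), with the operator space structure making $(\mathcal S_1^{A,X})^*=M_{A,X}$ via $\langle S,T\rangle={\rm Tr}(ST)$ a complete isometry; similarly $\mathcal S_1^{B,Y}$, and $\mathcal S_1^{AB,XY}$ (with $XY=X\times Y$, $AB=A\times B$) is identified with $\mathcal S_1^{A,X}\otimes\mathcal S_1^{B,Y}$. For a block operator isometry $W=(W_{(a,b),(x,y)})$ over $(XY,AB)$ with entries in $\mathcal B(H,K)$, $\phi_W:\mathcal S_1^{AB,XY}\to\mathcal B(H,K)$ is linear with $\phi_W(\epsilon_{(x,y),(a,b)})=W_{(a,b),(x,y)}$. An isometry $U:\mathbb C^X\to\mathbb C^A\otimes\mathbb C^S$ ($S$ finite) has entries $U_{a,x}\in\mathcal B(\mathbb C,\mathbb C^S)$ with $Ue_x=\sum_ae_a\otimes U_{a,x}$; likewise $V:\mathbb C^Y\to\mathbb C^B\otimes\mathbb C^T$; $U\otimes V$ has entries $U_{a,x}\otimes V_{b,y}$. $\mathcal R_{\rm loc}$ is the set of all finite (entrywise) direct sums of such $U\otimes V$. $\mathcal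 O^{\mathcal R_{\rm loc}}_{XY,AB}$ is $\mathcal S_1^{AB,XY}$ with matricial norms $\|u\|^{(n)}=\sup_{W\in\mathcal R_{\rm loc}}\|\phi^{(n)}_W(u)\|$. Let $R=(\ell_2)_r$, $C=(\ell_2)_c$ be row and column Hilbert operator spaces. An element $\omega\in M_n(\mathcal S_1^{A,X}\otimes\mathcal S_1^{B,Y})$ is regarded as a linear map $\omega:M_{A,X}\to M_n(\mathcal S_1^{B,Y})$ via the duality above, and $\|\omega\|^{(n)}_{w,{\rm cb}}=\sup\|\beta^{(n)}\circ\omega\circ\alpha\|_{\rm cb}$, the supremum over all complete contractions $\alpha:R\to M_{A,X}$ and $\beta:\mathcal S_1^{B,Y}\to C$; $\mathcal S_1^{A,X}\otimes_{w,{\rm cb}}\mathcal S_1^{B,Y}$ denotes $\mathcal S_1^{A,X}\otimes\mathcal S_1^{B,Y}$ with these matricial norms. *)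

(* Defs.v *)
From mathcomp Require Import all_boot all_algebra.
From mathcomp Require Import all_classical all_reals ereal.
From mathcomp Require Import complex.
Set Implicit Arguments.
Unset Strict Implicit.
Unset Printing Implicit Defensive.
Import GRing.Theory Num.Theory.
Local Open Scope ring_scope.
Local Open Scope classical_set_scope.

Definition cabs2 (R : realType) (z : R[i]) : R := complex.Re z ^+ 2 + complex.Im z ^+ 2.

Definition vnorm2 (R : realType) (J : finType) (v : J -> R[i]) : R :=
  \sum_(j : J) cabs2 (v j).

Definition opnorm (R : realType) (I J : finType) (M : I -> J -> R[i]) : \bar R :=
  ereal_sup [set (Num.sqrt (vnorm2 (fun i : I => \sum_(j : J) M i j * v j)))%:E
            | v in [set v : J -> R[i] | vnorm2 v <= 1]].

(* M_{A,X} : operators C^X -> C^A, i.e. A x X matrices T a x.          *)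
(* M_m(M_{A,X}) = M_{mA,mX} with the operator norm.                    *)
Definition mnorm_M (R : realType) (A X : finType) (m : nat)
    (t : 'I_m -> 'I_m -> A -> X -> R[i]) : \bar R :=
  opnorm (fun (p : 'I_m * A) (q : 'I_m * X) => t p.1 q.1 p.2 q.2).

(* S_1^{A,X} : operators C^A -> C^X, i.e. X x A matrices S x a          *)
(* (coefficient of the matrix unit eps_{x,a}).                         *)
Definition trpair (R : realType) (A X : finType)
    (S : X -> A -> R[i]) (T : A -> X -> R[i]) : R[i] :=
  \sum_(x : X) \sum_(a : A) S x a * T a x.

(* The operator space structure on S_1^{A,X} making (S_1^{A,X})^* = M_{A,X} *)
(* completely isometrically: ||u||_{M_n(S_1)} = || T |-> [<u_ij,T>] ||_cb, *)
(* the cb norm of the associated map M_{A,X} -> M_n, i.e. the sup over  *)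
(* m of the norms of its m-th amplifications.                          *)
Definition mnorm_S1 (R : realType) (A X : finType) (n : nat)
    (u : 'I_n -> 'I_n -> X -> A -> R[i]) : \bar R :=
  ereal_sup [set r | exists (m : nat) (t : 'I_m -> 'I_m -> A -> X -> R[i]),
     (mnorm_M t <= 1)%E /\
     r = opnorm (fun (p : 'I_m * 'I_n) (q : 'I_m * 'I_n) =>
                   trpair (u p.2 q.2) (t p.1 q.1))].

Definition l2 (R : realType) (f : nat -> R[i]) : Prop :=
  exists M : R, forall N : nat, \sum_(k < N) cabs2 (f k) <= M.

(* R = span{e_{1k}} in B(l_2): an element x = (x_ij) of M_I(R) is the   *)
(* operator with matrix entries x_ij(k) at (i,(j,k)) (an I x (I x N)     *)
(* matrix); its norm is the sup of the norms of the finite truncations. *)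
Definition rownorm (R : realType) (I : finType) (x : I -> I -> nat -> R[i]) : \bar R :=
  ereal_sup [set r | exists K : nat,
     r = opnorm (fun (i : I) (q : I * 'I_K) => x i q.1 (nat_of_ord q.2))].

(* C = span{e_{k1}} in B(l_2): an element y = (y_ij) of M_I(C) is the   *)
(* (I x N) x I matrix with entries y_ij(k) at ((i,k),j).                *)
Definition colnorm (R : realType) (I : finType) (y : I -> I -> nat -> R[i]) : \bar R :=
  ereal_sup [set r | exists K : nat,
     r = opnorm (fun (p : I * 'I_K) (j : I) => y p.1 j (nat_of_ord p.2))].

Definition compl_contr_R_M (R : realType) (A X : finType)
    (alpha : (nat -> R[i]) -> (A -> X -> R[i])) : Prop :=
  (forall (c : R[i]) (g h : nat -> R[i]), l2 g -> l2 h ->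
     alpha (fun k => c * g k + h k) = fun a x => c * alpha g a x + alpha h a x) /\
  forall (m : nat) (x : 'I_m -> 'I_m -> nat -> R[i]),
    (forall i j, l2 (x i j)) -> (rownorm x <= 1)%E ->
    (mnorm_M (fun i j => alpha (x i j)) <= 1)%E.

Definition compl_contr_S1_C (R : realType) (B Y : finType)
    (beta : (Y -> B -> R[i]) -> (nat -> R[i])) : Prop :=
  (forall S, l2 (beta S)) /\
  (forall (c : R[i]) (S S' : Y -> B -> R[i]),
     beta (fun y b => c * S y b + S' y b) = fun k => c * beta S k + beta S' k) /\
  forall (m : nat) (v : 'I_m -> 'I_m -> Y -> B -> R[i]),
    (mnorm_S1 v <= 1)%E ->
    (colnorm (fun i j => beta (v i j)) <= 1)%E.

(* omega in M_n(S_1^{A,X} (x) S_1^{B,Y}), stored with the identification *)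
(* eps_{(x,y),(a,b)} <-> eps_{x,a} (x) eps_{y,b}: u i j (x,y) (a,b) is   *)
(* the coefficient of eps_{x,a} (x) eps_{y,b} in the (i,j) entry.        *)
(* As a map M_{A,X} -> M_n(S_1^{B,Y}) (pairing on the first factor):     *)
Definition omega_map (R : realType) (X Y A B : finType) (n : nat)
    (u : 'I_n -> 'I_n -> (X * Y)%type -> (A * B)%type -> R[i])
    (T : A -> X -> R[i]) : 'I_n -> 'I_n -> Y -> B -> R[i] :=
  fun i j y b => \sum_(x : X) \sum_(a : A) u i j (x, y) (a, b) * T a x.

Definition cbnorm_R_MnC (R : realType) (n : nat)
    (Phi : (nat -> R[i]) -> 'I_n -> 'I_n -> nat -> R[i]) : \bar R :=
  ereal_sup [set r | exists (m : nat) (x : 'I_m -> 'I_m -> nat -> R[i]),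
     (forall i j, l2 (x i j)) /\ (rownorm x <= 1)%E /\
     r = colnorm (fun (p q : 'I_m * 'I_n) => Phi (x p.1 q.1) p.2 q.2)].

Definition wcb_norm (R : realType) (X Y A B : finType) (n : nat)
    (u : 'I_n -> 'I_n -> (X * Y)%type -> (A * B)%type -> R[i]) : \bar R :=
  ereal_sup [set r | exists (alpha : (nat -> R[i]) -> (A -> X -> R[i]))
                            (beta : (Y -> B -> R[i]) -> (nat -> R[i])),
     compl_contr_R_M alpha /\ compl_contr_S1_C beta /\
     r = cbnorm_R_MnC (fun f i j => beta (omega_map u (alpha f) i j))].

(* An isometry U : C^X -> C^A (x) C^S, S = 'I_s, with entries          *)
(* U_{a,x} in B(C, C^S) = C^S, given by U a x : 'I_s -> C               *)
(* (U e_x = sum_a e_a (x) U_{a,x}); isometry means U^* U = 1.          *)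
Definition isometry_entries (R : realType) (A X : finType) (s : nat)
    (U : A -> X -> 'I_s -> R[i]) : Prop :=
  forall x x' : X,
    \sum_(a : A) \sum_(k < s) conjc (U a x k) * U a x' k = (x == x')%:R.

(* A finite direct sum W = (+)_{l < N} U_l (x) V_l with                  *)
(* U_l : C^X -> C^A (x) C^{'I_(s l)}, V_l : C^Y -> C^B (x) C^{'I_(t l)}. *)
(* W_{(a,b),(x,y)} in B(C^N, (+)_l C^{s l} (x) C^{t l}) is block diagonal *)
(* with l-th block U_l{a,x} (x) V_l{b,y}; the output index set is         *)
(* {l : 'I_N & 'I_(s l) * 'I_(t l)}, the input index set is 'I_N.         *)
Definition Wentry (R : realType) (X Y A B : finType) (N : nat)
    (s t : 'I_N -> nat)
    (U : forall l : 'I_N, A -> X -> 'I_(s l) -> R[i])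
    (V : forall l : 'I_N, B -> Y -> 'I_(t l) -> R[i])
    (ab : (A * B)%type) (xy : (X * Y)%type)
    (k : {l : 'I_N & ('I_(s l) * 'I_(t l))%type}) (l' : 'I_N) : R[i] :=
  if tag k == l' then
    U (tag k) ab.1 xy.1 (tagged k).1 * V (tag k) ab.2 xy.2 (tagged k).2
  else 0.

(* ||phi_W^(n)(u)|| for W as above: phi_W(eps_{(x,y),(a,b)}) = W_{(a,b),(x,y)}. *)
Definition phiW_norm (R : realType) (X Y A B : finType) (N : nat)
    (s t : 'I_N -> nat)
    (U : forall l : 'I_N, A -> X -> 'I_(s l) -> R[i])
    (V : forall l : 'I_N, B -> Y -> 'I_(t l) -> R[i])
    (n : nat) (u : 'I_n -> 'I_n -> (X * Y)%type -> (A * B)%type -> R[i]) : \bar R :=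
  opnorm (fun (p : 'I_n * {l : 'I_N & ('I_(s l) * 'I_(t l))%type}) (q : 'I_n * 'I_N) =>
    \sum_(xy : (X * Y)%type) \sum_(ab : (A * B)%type)
       u p.1 q.1 xy ab * Wentry U V ab xy p.2 q.2).

Definition loc_norm (R : realType) (X Y A B : finType) (n : nat)
    (u : 'I_n -> 'I_n -> (X * Y)%type -> (A * B)%type -> R[i]) : \bar R :=
  ereal_sup [set r | exists (N : nat) (s t : 'I_N -> nat)
       (U : forall l : 'I_N, A -> X -> 'I_(s l) -> R[i])
       (V : forall l : 'I_N, B -> Y -> 'I_(t l) -> R[i]),
     (forall l, isometry_entries (U l)) /\ (forall l, isometry_entries (V l)) /\
     r = phiW_norm U V u].

(* Main.v *)
Require Import Defs.
From mathcomp Require Import all_boot all_order all_algebra.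
From mathcomp Require Import all_classical all_reals ereal.
From mathcomp Require Import complex.
From mathcomp Require Import spectral ring lra.
Set Implicit Arguments.
Unset Strict Implicit.
Unset Printing Implicit Defensive.
Import Order.TTheory GRing.Theory Num.Theory.
Local Open Scope ring_scope.

(* A complete contraction alpha : R -> M_{A,X} amounts to a contraction
   U : C^X -> C^A (x) l_2, namely U_{a,x} = (alpha(e_k)_{a,x})_k, because
   CB(R, M_{A,X}) is the column space over M_{A,X}; likewise a complete
   contraction beta : S_1^{B,Y} -> C amounts to a contraction
   V : C^Y -> C^B (x) l_2.  Under this dictionary the completely bounded norm
   of beta^(n) o omega o alpha is the norm of the column
   sum u_{(x,y),(a,b)} U_{a,x} (x) V_{b,y}, so the two norms are the same
   supremum, up to three adjustments: l_2 is truncated to finitely many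
   coordinates (the tails contribute arbitrarily little), a contraction is
   completed to an isometry by appending a square root of its defect
   1 - U^* U, and the norm of a direct sum is the maximum of the norms of its
   blocks. *)

Lemma sum_pair (V : nmodType) (I J : finType) (F : I * J -> V) :
  \sum_p F p = \sum_i \sum_j F (i, j).
Proof. by rewrite pair_bigA; apply: eq_bigr => -[]. Qed.

(** * Squared norms of finite complex vectors *)

Section Vectors.
Variable R : realType.
Local Notation C := (R[i]).

Lemma cabs2_ge0 (z : C) : 0 <= cabs2 z.
Proof. by rewrite addr_ge0 ?sqr_ge0. Qed.

Lemma cabs20 : cabs2 (0 : C) = 0.
Proof. by rewrite /cabs2 /= expr0n addr0. Qed.

Lemma cabs2M (x y : C) : cabs2 (x * y) = cabs2 x * cabs2 y.
Proof. by case: x y => [a b] [c d]; rewrite /cabs2 /=; ring. Qed.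

Lemma vnorm2_ge0 (J : finType) (v : J -> C) : 0 <= vnorm2 v.
Proof. by apply: sumr_ge0 => j _; apply: cabs2_ge0. Qed.

Lemma eq_vnorm2 (J : finType) (v w : J -> C) : v =1 w -> vnorm2 v = vnorm2 w.
Proof. by move=> vw; apply: eq_bigr => j _; rewrite vw. Qed.

Lemma vnorm2Z (J : finType) (c : C) (v : J -> C) :
  vnorm2 (fun j => c * v j) = cabs2 c * vnorm2 v.
Proof. by rewrite /vnorm2 mulr_sumr; apply: eq_bigr => j _; rewrite cabs2M. Qed.

Lemma vnorm2_pair (I J : finType) (v : I * J -> C) :
  vnorm2 v = \sum_i vnorm2 (fun j => v (i, j)).
Proof. exact: sum_pair. Qed.

(** A partial injection [h], with [None] for a zero coordinate, covers restriction, zero padding and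
    truncation at once: each entry of [w] is copied at most once. *)
Lemma vnorm2_oapp (I I' : finType) (h : I' -> option I) (w : I -> C) :
  (forall i j, h i = h j -> h i -> i = j) ->
  vnorm2 (fun i' => oapp w 0 (h i')) <= vnorm2 w.
Proof.
move=> hinj; pose F i' i := if h i' == Some i then cabs2 (w i) else 0.
have -> : vnorm2 (fun i' => oapp w 0 (h i')) = \sum_i' \sum_i F i' i.
  apply: eq_bigr => i' _; rewrite /F -big_mkcond /=.
  case: (h i') => [i|] /=; last by rewrite cabs20 big_pred0.
  by rewrite (big_pred1 i) // => j /=; rewrite eq_sym.
rewrite exchange_big /=; apply: ler_sum => i _; rewrite /F -big_mkcond /=.
have [i0 /eqP hi0|h0] := pickP (fun i' => h i' == Some i); last first.
  by rewrite big_pred0 // cabs2_ge0.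
rewrite (big_pred1 i0) // => j /=; apply/eqP/eqP => [hj|->//].
by apply: hinj; rewrite hj // hi0.
Qed.

(** The adjoint of the previous operation. A fibre of [h] has at most one point, so the sum only
    selects a coordinate through the partial inverse of [h]. *)
Lemma vnorm2_fiber (J J' : finType) (h : J' -> option J) (v : J' -> C) :
  (forall i j, h i = h j -> h i -> i = j) ->
  vnorm2 (fun j => \sum_(j' | h j' == Some j) v j') <= vnorm2 v.
Proof.
move=> hinj.
pose k j := [pick j' | h j' == Some j].
rewrite (@eq_vnorm2 _ _ (fun j => oapp v 0 (k j))); last first.
  move=> j; rewrite /k; case: pickP => [j0 /eqP hj0|h0] /=; last first.
    by rewrite big_pred0.
  rewrite (big_pred1 j0) // => j' /=; apply/eqP/eqP => [hj|->//].
  by apply: hinj; rewrite hj // hj0.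
apply: vnorm2_oapp => i j; rewrite /k.
case: pickP => [i0 /eqP hi0|//]; case: pickP => [j0 /eqP hj0|//] [e] _.
by move: hi0; rewrite e hj0 => -[].
Qed.

Lemma vnorm2_comp (I I' : finType) (f : I' -> I) (w : I -> C) :
  injective f -> vnorm2 (fun i' => w (f i')) <= vnorm2 w.
Proof.
by move=> finj; apply: (@vnorm2_oapp _ _ (fun i => Some (f i))) => i j [/finj].
Qed.

Lemma Re_sum (I : finType) (z : I -> C) :
  complex.Re (\sum_i z i) = \sum_i complex.Re (z i).
Proof. exact: (raddf_sum (@complex.Re R)). Qed.

Lemma Im_sum (I : finType) (z : I -> C) :
  complex.Im (\sum_i z i) = \sum_i complex.Im (z i).
Proof. exact: (raddf_sum (@complex.Im R)). Qed.

(* Lagrange's identity: twice the defect is the sum over [k, l] of the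
   squared moduli of [a_k conj(b_l) - a_l conj(b_k)]. *)
Lemma cauchy_schwarz (I : finType) (a b : I -> C) :
  cabs2 (\sum_i a i * b i) <= vnorm2 a * vnorm2 b.
Proof.
pose z k l := cabs2 (a k * conjc (b l) - a l * conjc (b k)).
pose p k := complex.Re (a k * b k); pose q k := complex.Im (a k * b k).
have zE k l : z k l = cabs2 (a k) * cabs2 (b l) + cabs2 (b k) * cabs2 (a l)
    - (2 * p k * p l + 2 * q k * q l).
  rewrite /z /p /q /cabs2; case: (a k) (a l) (b k) (b l) => [? ?] [? ?] [? ?] [? ?] /=.
  by ring.
have : 0 <= \sum_k \sum_l z k l.
  by apply: sumr_ge0 => k _; apply: sumr_ge0 => l _; apply: cabs2_ge0.
have -> : \sum_k \sum_l z k l =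
    2 * (vnorm2 a * vnorm2 b) - 2 * cabs2 (\sum_i a i * b i).
  have S (f g : I -> R) : \sum_k \sum_l f k * g l = (\sum_k f k) * (\sum_l g l).
    by rewrite big_distrlr.
  under eq_bigr => k _ do under eq_bigr => l _ do rewrite zE.
  under eq_bigr => k _ do rewrite sumrB (big_split _ _ _ (fun l => 2 * p k * p l)) big_split /=.
  rewrite sumrB (big_split _ _ _ (fun k => \sum_l 2 * p k * p l)) big_split /= !S.
  rewrite -!mulr_sumr /cabs2 Re_sum Im_sum /vnorm2 /cabs2 -/(p _).
  by ring.
by rewrite -mulrBr pmulr_rge0 ?ltr0n // subr_ge0.
Qed.

(* Stated with a free parameter [d] so that square roots are avoided. *)
Lemma vnorm2D_le (I : finType) (v w : I -> C) (d : R) : 0 < d ->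
  vnorm2 (fun i => v i + w i) <= (1 + d) * vnorm2 v + (1 + d^-1) * vnorm2 w.
Proof.
move=> d0; rewrite /vnorm2 !mulr_sumr -big_split /=; apply: ler_sum => i _.
case: (v i) (w i) => [a b] [a' b']; rewrite /cabs2 /= -subr_ge0.
suff -> : (1 + d) * (a ^+ 2 + b ^+ 2) + (1 + d^-1) * (a' ^+ 2 + b' ^+ 2)
    - ((a + a') ^+ 2 + (b + b') ^+ 2)
   = d^-1 * ((d * a - a') ^+ 2 + (d * b - b') ^+ 2).
  by rewrite mulr_ge0 ?invr_ge0 ?(ltW d0) // addr_ge0 ?sqr_ge0.
by field; rewrite gt_eqF.
Qed.

End Vectors.

(** * Operator norms as bounds on squared norms *)

Section Operators.
Variable R : realType.
Local Notation C := (R[i]).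

Definition mvmul (I J : finType) (M : I -> J -> C) (v : J -> C) : I -> C :=
  fun i => \sum_j M i j * v j.

(* The operator norm of [M] is at most the square root of [c]. *)
Definition sqbounded (I J : finType) (M : I -> J -> C) (c : R) : Prop :=
  forall v, vnorm2 (mvmul M v) <= c * vnorm2 v.

(** The Hilbert-Schmidt bound, from Cauchy-Schwarz on each row. *)
Lemma sqbounded_frobenius (I J : finType) (M : I -> J -> C) :
  sqbounded M (\sum_i vnorm2 (M i)).
Proof.
move=> v; rewrite mulr_suml; apply: ler_sum => i _; exact: cauchy_schwarz.
Qed.

Lemma mvmulZ (I J : finType) (M : I -> J -> C) (c : C) (v : J -> C) i :
  mvmul M (fun j => c * v j) i = c * mvmul M v i.
Proof. by rewrite /mvmul mulr_sumr; apply: eq_bigr => j _; rewrite mulrCA. Qed.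

Lemma opnorm_ge0 (I J : finType) (M : I -> J -> C) : (0 <= opnorm M)%E.
Proof.
apply: (@le_trans _ _ (Num.sqrt (vnorm2 (mvmul M (fun _ => 0))))%:E).
  by rewrite lee_fin sqrtr_ge0.
apply: ereal_sup_ubound; exists (fun _ => 0) => //=.
by rewrite /vnorm2 big1 ?ler01 // => j _; rewrite cabs20.
Qed.

Lemma opnorm_leP (I J : finType) (M : I -> J -> C) (L : R) : 0 <= L ->
  (opnorm M <= L%:E)%E <-> sqbounded M (L ^+ 2).
Proof.
move=> L0; split=> [ML v|ML].
  (* A vector of norm zero cannot be rescaled to the unit sphere; the Hilbert-Schmidt bound shows
     that [M] kills it. *)
  have [v0|v0] := eqVneq (vnorm2 v) 0.
    by apply: le_trans (sqbounded_frobenius M v) _; rewrite v0 !mulr0.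
  have vgt : 0 < vnorm2 v by rewrite lt_neqAle eq_sym v0 vnorm2_ge0.
  pose c : C := ((Num.sqrt (vnorm2 v))^-1)%:C%C.
  have c2 : cabs2 c = (vnorm2 v)^-1.
    by rewrite /cabs2 /= expr0n addr0 exprVn sqr_sqrtr ?vnorm2_ge0.
  have Mcv :
      ((Num.sqrt (vnorm2 (mvmul M (fun j => c * v j))))%:E <= opnorm M)%E.
    apply: ereal_sup_ubound; exists (fun j => c * v j) => //=.
    by rewrite vnorm2Z c2 mulVf.
  have := le_trans Mcv ML; rewrite lee_fin (eq_vnorm2 (mvmulZ M c v)) vnorm2Z c2.
  rewrite -[X in _ <= X]ger0_norm // -sqrtr_sqr ler_sqrt ?sqr_ge0 //.
  by rewrite mulrC ler_pdivrMr.
apply: ub_ereal_sup => _ [v /= v1 <-]; rewrite lee_fin.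
rewrite -[X in _ <= X]ger0_norm // -sqrtr_sqr ler_sqrt ?sqr_ge0 //.
by apply: le_trans (ML v) _; rewrite ler_piMr ?sqr_ge0.
Qed.

Lemma opnorm_le1P (I J : finType) (M : I -> J -> C) :
  (opnorm M <= 1)%E <-> sqbounded M 1.
Proof. by have := opnorm_leP M (ler01 : 0 <= 1 :> R); rewrite expr1n. Qed.

Lemma eq_sqbounded (I J : finType) (M M' : I -> J -> C) c :
  M =2 M' -> sqbounded M c -> sqbounded M' c.
Proof.
move=> MM' Mc v; rewrite -(@eq_vnorm2 _ _ (mvmul M v)) // => i.
by apply: eq_bigr => j _; rewrite MM'.
Qed.

(** Here [M'] is [M] between two coordinate partial isometries: [vnorm2_fiber] bounds the one on the
    input, [vnorm2_oapp] the one on the output. *)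
Lemma sqbounded_pad (I J I' J' : finType) (hr : I' -> option I)
    (hc : J' -> option J) (M : I -> J -> C) (M' : I' -> J' -> C) c : 0 <= c ->
  (forall i j, hr i = hr j -> hr i -> i = j) ->
  (forall i j, hc i = hc j -> hc i -> i = j) ->
  (forall i j, M' i j =
    if hr i is Some i0 then if hc j is Some j0 then M i0 j0 else 0 else 0) ->
  sqbounded M c -> sqbounded M' c.
Proof.
move=> c0 hri hci M'E Mc v.
pose w q := \sum_(j' | hc j' == Some q) v j'.
rewrite (@eq_vnorm2 _ _ _ (fun i' => oapp (mvmul M w) 0 (hr i'))).
  apply: le_trans (vnorm2_oapp _ hri) _; apply: le_trans (Mc w) _.
  by rewrite ler_wpM2l // vnorm2_fiber.
move=> i'; rewrite /mvmul; under eq_bigr => j _ do rewrite M'E.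
case: (hr i') => [i|] /=; last by rewrite big1 // => j _; rewrite mul0r.
under [RHS]eq_bigr => j _ do rewrite mulr_sumr big_mkcond /=.
rewrite exchange_big /=; apply: eq_bigr => j' _; rewrite -big_mkcond /=.
case: (hc j') => [j|] /=; last by rewrite mul0r big_pred0.
by rewrite (big_pred1 j) // => k /=; rewrite eq_sym.
Qed.

Lemma sqbounded_sub (I J I' J' : finType) (f : I' -> I) (g : J' -> J)
    (M : I -> J -> C) (M' : I' -> J' -> C) c : 0 <= c ->
  injective f -> injective g -> (forall i j, M' i j = M (f i) (g j)) ->
  sqbounded M c -> sqbounded M' c.
Proof.
move=> c0 finj ginj M'E Mc v.
(* The partial inverse of [g] extends [v] by zero to a vector [w], and [M' v] is then a restriction
   of [M w]. *)
pose h j := [pick j' | g j' == j].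
pose w j := oapp v 0 (h j).
have hg j' : h (g j') = Some j'.
  rewrite /h; case: pickP => [k /eqP/ginj -> //|/(_ j')]; by rewrite eqxx.
rewrite (@eq_vnorm2 _ _ _ (fun i' => mvmul M w (f i'))).
  apply: le_trans (vnorm2_comp _ finj) _; apply: le_trans (Mc w) _.
  rewrite ler_wpM2l // vnorm2_oapp // => i j; rewrite /h.
  case: pickP => [i0 /eqP <-|//]; case: pickP => [j0 /eqP <-|//].
  by move=> [->].
move=> i'; rewrite /mvmul (bigID (fun j => h j)) /= [X in _ + X]big1 ?addr0.
  rewrite (reindex_omap g h) /=.
    apply: eq_big => j'; first by rewrite hg /= eqxx.
    by rewrite M'E /w hg.
  by move=> j; rewrite /h; case: pickP => //= j' /eqP ->.
by move=> j; rewrite /w; case: (h j) => //=; rewrite mulr0.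
Qed.

(** The matrix is the product of [x] tensored with the identity of [E] and [phi] tensored with the
    identity of [J]. This is how a row contraction acts on a column over an operator space. *)
Lemma sqbounded_slice (I J K E F : finType) (x : I -> J * K -> C)
    (phi : E * K -> F -> C) c : sqbounded x 1 -> sqbounded phi c ->
  sqbounded (fun (p : I * E) (q : J * F) =>
    \sum_k x p.1 (q.1, k) * phi (p.2, k) q.2) c.
Proof.
move=> x1 phic v; set M := fun _ => _.
pose w j := mvmul phi (fun f => v (j, f)).
have ME i e : mvmul M v (i, e) = mvmul x (fun q => w q.1 (e, q.2)) i.
  rewrite /mvmul /M !sum_pair /=.
  apply: eq_bigr => j _; rewrite /w /mvmul.
  under eq_bigr => f _ do rewrite mulr_suml.
  rewrite exchange_big /=; apply: eq_bigr => k _; rewrite mulr_sumr.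
  by apply: eq_bigr => f _; rewrite mulrA.
rewrite (vnorm2_pair (mvmul M v)) (vnorm2_pair v) exchange_big /=.
apply: (@le_trans _ _ (\sum_e vnorm2 (fun q : J * K => w q.1 (e, q.2)))).
  apply: ler_sum => e _; rewrite -[X in _ <= X]mul1r.
  apply: le_trans (x1 _); rewrite le_eqVlt; apply/orP; left; apply/eqP.
  by apply: eq_bigr => i _; rewrite ME.
under [X in X <= _]eq_bigr => e _ do rewrite vnorm2_pair.
rewrite exchange_big mulr_sumr /=; apply: ler_sum => j _.
by apply: le_trans (phic _); rewrite [X in _ <= X]vnorm2_pair.
Qed.

(** The blocks have mutually orthogonal domains and ranges, so the squared norms add up over [l]. *)
Lemma sqbounded_blockdiag (L : finType) (T : L -> finType) (I J : finType)
    (phi : forall l, I -> T l -> J -> C) c :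
  (forall l, sqbounded (fun p : I * T l => phi l p.1 p.2) c) ->
  sqbounded (fun (p : I * {l : L & T l}) (q : J * L) =>
    if tag p.2 == q.2 then phi (tag p.2) p.1 (tagged p.2) q.1 else 0) c.
Proof.
move=> phic v; set M := fun _ => _.
pose w l := mvmul (fun p : I * T l => phi l p.1 p.2) (fun j => v (j, l)).
have ME i t : mvmul M v (i, t) = w (tag t) (i, tagged t).
  rewrite /mvmul /w /mvmul /M sum_pair /=.
  apply: eq_bigr => j _.
  rewrite (bigD1 (tag t)) //= eqxx big1 ?addr0 // => l.
  by rewrite eq_sym => /negbTE ->; rewrite mul0r.
rewrite vnorm2_pair.
rewrite (eq_bigr (fun i => \sum_l vnorm2 (fun t => w l (i, t)))); last first.
  move=> i _; rewrite (@sig_big_dep _ _ _ _ T predT (fun _ => predT) (fun l t => cabs2 (w l (i, t)))) /=.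
  by apply: eq_bigr => t _; rewrite ME.
rewrite exchange_big /= (vnorm2_pair v) [X in _ <= _ * X]exchange_big mulr_sumr /=.
apply: ler_sum => l _.
by apply: le_trans (phic l _); rewrite [X in _ <= X]vnorm2_pair.
Qed.

End Operators.

(** * Gram matrices and the dilation of contractions to isometries *)

Section Isometries.
Variable R : realType.
Local Notation C := (R[i]).

Lemma cabs2E (z : C) : (cabs2 z)%:C%C = conjc z * z.
Proof. by case: z => a b; apply/eqP; rewrite eq_complex /cabs2 /=; apply/andP; split; apply/eqP; ring. Qed.

Lemma vnorm2E (J : finType) (v : J -> C) :
  (vnorm2 v)%:C%C = \sum_j conjc (v j) * v j.
Proof. by rewrite rmorph_sum; apply: eq_bigr => j _; rewrite -cabs2E. Qed.

Lemma vnorm2_mvmul (I J : finType) (M : I -> J -> C) (v : J -> C) :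
  (vnorm2 (mvmul M v))%:C%C =
  \sum_x \sum_y conjc (v x) * v y * \sum_i conjc (M i x) * M i y.
Proof.
rewrite vnorm2E /mvmul.
under eq_bigr => i _ do rewrite rmorph_sum big_distrlr /=.
rewrite exchange_big; apply: eq_bigr => x _ /=.
rewrite exchange_big; apply: eq_bigr => y _ /=.
by rewrite mulr_sumr; apply: eq_bigr => i _; rewrite rmorphM /=; ring.
Qed.

Lemma sum_delta (X : finType) (v w : X -> C) :
  \sum_x \sum_y conjc (v x) * w y * (x == y)%:R = \sum_x conjc (v x) * w x.
Proof.
apply: eq_bigr => x _; rewrite (bigD1 x) //= eqxx mulr1 big1 ?addr0 // => y.
by rewrite eq_sym => /negbTE ->; rewrite mulr0.
Qed.

Lemma isometry_sqbounded (A X : finType) s (U : A -> X -> 'I_s -> C) :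
  isometry_entries U -> sqbounded (fun (p : A * 'I_s) x => U p.1 x p.2) 1.
Proof.
move=> isoU v; rewrite mul1r le_eqVlt; apply/orP; left; apply/eqP.
apply: complexI; rewrite vnorm2_mvmul vnorm2E -sum_delta.
apply: eq_bigr => x _; apply: eq_bigr => y _.
by rewrite sum_pair isoU.
Qed.

(** By the spectral theorem [G] is [P^* diag(sp) P] with [P] unitary, and [D] is
    [diag(sqrt sp) P]. *)
Lemma psd_factor (X : finType) (G : X -> X -> C) :
  (forall x y, conjc (G x y) = G y x) ->
  (forall v : X -> C, 0 <= \sum_x \sum_y conjc (v x) * v y * G x y) ->
  exists D : 'I_#|X| -> X -> C,
    forall x y, \sum_k conjc (D k x) * D k y = G x y.
Proof.
move=> Gh Gp.
pose A := (\matrix_(i, j) G (enum_val i) (enum_val j)) : 'M[C]_#|X|.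
have Ah : A \is hermsymmx.
  apply/is_hermitianmxP; rewrite expr0 scale1r.
  by apply/matrixP => i j; rewrite !mxE -Gh.
have /orthomx_spectralP := hermitian_normalmx Ah.
set P := spectralmx A; set sp := spectral_diag A => AE.
have Pu : P \is unitarymx by apply: spectral_unitarymx.
(* Each eigenvalue is the value of the form at a conjugated row of [P], hence nonnegative. *)
have spE k : sp 0 k = \sum_x \sum_y P k (enum_rank x) * conjc (P k (enum_rank y)) * G x y.
  have : P *m A *m invmx P = diag_mx sp.
    by rewrite AE mulmxA mulmxK ?spectral_unit // mulKVmx ?spectral_unit.
  move=> /matrixP /(_ k k); rewrite [in RHS]mxE eqxx mulr1n => <-.
  rewrite invmx_unitary // mxE [RHS]exchange_big /=.
  rewrite [RHS](reindex (@enum_val X X)) /=; last exact/onW_bij/enum_val_bij.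
  apply: eq_bigr => j _; rewrite mxE mulr_suml.
  rewrite [RHS](reindex (@enum_val X X)) /=; last exact/onW_bij/enum_val_bij.
  by apply: eq_bigr => i _; rewrite !mxE !enum_valK mulrAC.
have sp0 k : 0 <= sp 0 k.
  rewrite spE; have := Gp (fun x => conjc (P k (enum_rank x))).
  by under eq_bigr => x _ do under eq_bigr => y _ do rewrite conjcK.
exists (fun k x => sqrtC (sp 0 k) * P k (enum_rank x)) => x y.
have -> : G x y = A (enum_rank x) (enum_rank y) by rewrite mxE !enum_rankK.
rewrite AE invmx_unitary // !mxE; apply: eq_bigr => k _.
rewrite mul_mx_diag !mxE rmorphM /=.
have -> : conjc (sqrtC (sp 0 k)) = sqrtC (sp 0 k).
  by apply/conj_Creal/ger0_real; rewrite sqrtC_ge0.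
rewrite mulrCA !mulrA -expr2 sqrtCK; by rewrite [sp 0 k * _]mulrC.
Qed.

(* The defect [1 - U^* U = D^* D] is stored, through [D], in fresh
   coordinates next to a single row [a0]. *)
Lemma contraction_dilation (A X : finType) s (U : A -> X -> 'I_s -> C) :
  (0 < #|A|)%N -> sqbounded (fun (p : A * 'I_s) x => U p.1 x p.2) 1 ->
  exists s' (U' : A -> X -> 'I_(s + s') -> C),
    isometry_entries U' /\ forall a x k, U' a x (lshift s' k) = U a x k.
Proof.
move=> /card_gt0P[a0 _] U1.
pose G x y : C := (x == y)%:R - \sum_(p : A * 'I_s) conjc (U p.1 x p.2) * U p.1 y p.2.
have [x y|v|D DE] := @psd_factor X G.
- rewrite /G rmorphB rmorph_sum rmorph_nat eq_sym; congr (_ - _).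
  by apply: eq_bigr => p _; rewrite rmorphM /= conjcK mulrC.
(* Positivity of the defect form is contractivity of [U]. *)
- have -> : \sum_x \sum_y conjc (v x) * v y * G x y =
      (vnorm2 v - vnorm2 (mvmul (fun (p : A * 'I_s) x => U p.1 x p.2) v))%:C%C.
    rewrite rmorphB /= vnorm2_mvmul vnorm2E -sum_delta -sumrB.
    apply: eq_bigr => x _; rewrite -sumrB; apply: eq_bigr => y _.
    by rewrite mulrBr.
  by rewrite ler0c subr_ge0 -[leRHS]mul1r.
exists #|X|; exists (fun a x (k : 'I_(s + #|X|)) =>
  match fintype.split k with inl k => U a x k | inr k => if a == a0 then D k x else 0 end).
split=> [x y|a x k]; last by rewrite (unsplitK (inl k)).
under eq_bigr => a _ do rewrite big_split_ord /=.
rewrite big_split /= [X in _ + X](bigD1 a0) //= [X in _ + (_ + X)]big1 ?addr0.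
  have -> : (x == y)%:R = \sum_a \sum_(k < s) conjc (U a x k) * U a y k + G x y.
    by rewrite /G sum_pair /= addrC subrK.
  congr (_ + _).
    apply: eq_bigr => a _; apply: eq_bigr => k _.
    by rewrite (unsplitK (inl k)).
  rewrite -DE; apply: eq_bigr => k _.
  by rewrite (unsplitK (inr k)) eqxx.
move=> a /negbTE a_a0; apply: big1 => k _.
by rewrite (unsplitK (inr k)) a_a0 mulr0.
Qed.

End Isometries.

(** * A single tensor of contractions, bounded by both norms *)

Section LocalTensors.
Variable R : realType.
Local Notation C := (R[i]).

Lemma le_opnorm (I J I' J' : finType) (M : I -> J -> C) (M' : I' -> J' -> C) :
  (forall c, 0 <= c -> sqbounded M c -> sqbounded M' c) ->
  (opnorm M' <= opnorm M)%E.
Proof.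
move=> MM'; have := opnorm_ge0 M; case E : (opnorm M) => [r||] //=; last by move=> _; rewrite leey.
rewrite lee_fin => r0; apply/opnorm_leP => //; apply: MM'; first exact: sqr_ge0.
by apply/opnorm_leP => //; rewrite E.
Qed.

Lemma insub_inj_some (m n : nat) (i j : 'I_m) :
  (insub (i : nat) : option 'I_n) = insub (j : nat) ->
  (insub (i : nat) : option 'I_n) -> i = j.
Proof.
case: insubP => [k _ ki|//]; case: insubP => [l _ lj|//] [kl] _.
by apply/val_inj; rewrite /= -ki -lj kl.
Qed.

Lemma l2_finsupp (f : nat -> C) N : (forall k, (N <= k)%N -> f k = 0) -> l2 f.
Proof.
move=> f0; exists (vnorm2 (fun k : 'I_N => f k)) => K.
rewrite -/(vnorm2 (fun k : 'I_K => f k)).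
rewrite (@eq_vnorm2 _ _ _ (fun k : 'I_K => oapp (fun l : 'I_N => f l) 0 (insub (k : nat)))).
  by apply: vnorm2_oapp => i j; apply: insub_inj_some.
by move=> k; case: insubP => [l _ <- //|]; rewrite -leqNgt => /f0.
Qed.

(** The element of [M_{m+1}(R)] whose first column lists the basis vectors [e_0, ..., e_m].
    Amplified maps out of [R] are tested on it: its image lists their values on the basis as a
    column. *)
Definition basis_column m (p q : 'I_m.+1) (k : nat) : C :=
  ((q == ord0) && (p == k :> nat))%:R.

Lemma l2_basis_column m (p q : 'I_m.+1) : l2 (basis_column p q).
Proof.
apply: (@l2_finsupp _ m.+1) => k mk; rewrite /basis_column.
by rewrite (ltn_eqF (leq_trans (ltn_ord p) mk)) andbF.
Qed.

Lemma rownorm_basis_column m : (rownorm (@basis_column m) <= 1)%E.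
Proof.
apply: ub_ereal_sup => _ [K ->]; apply/opnorm_le1P.
(* Each truncation is an identity matrix with some rows and columns deleted or filled with zeros. *)
apply: (@sqbounded_pad _ _ _ _ _ (fun p : 'I_m.+1 => insub (p : nat))
  (fun q => if q.1 == ord0 then Some q.2 else None)
  (fun i j : 'I_K => (i == j)%:R)) => //.
- by move=> i j; apply: insub_inj_some.
- move=> [i k] [j l] /=; have [->|//] := eqVneq i ord0.
  by have [->|//] := eqVneq j ord0; case=> ->.
- move=> p [q k]; rewrite /basis_column /=; case: insubP => [l _ <-|] /=.
    by case: eqP.
  rewrite -leqNgt => Kp; have -> : (p == k :> nat) = false.
    by rewrite gtn_eqF // (leq_trans (ltn_ord k)).
  by rewrite andbF.
move=> v; rewrite mul1r (@eq_vnorm2 _ _ _ v) // => i.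
rewrite /mvmul (bigD1 i) //= eqxx mul1r big1 ?addr0 // => j.
by rewrite eq_sym => /negbTE ->; rewrite mul0r.
Qed.

Variables (X Y A B : finType).

(** One summand of [phi_W(u)], for [U (x) V], written through [omega_map] so that it can be compared
    with the other norm; [locmxE] gives the direct formula. *)
Definition locmx n (u : 'I_n -> 'I_n -> X * Y -> A * B -> C) s t
    (U : A -> X -> 'I_s -> C) (V : B -> Y -> 'I_t -> C)
    (p : 'I_n * ('I_s * 'I_t)) (j : 'I_n) : C :=
  \sum_y \sum_b omega_map u (fun a x => U a x p.2.1) p.1 j y b * V b y p.2.2.

Lemma locmxE n (u : 'I_n -> 'I_n -> X * Y -> A * B -> C) s t
    (U : A -> X -> 'I_s -> C) (V : B -> Y -> 'I_t -> C) p j :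
  locmx u U V p j = \sum_xy \sum_ab
    u p.1 j xy ab * (U ab.1 xy.1 p.2.1 * V ab.2 xy.2 p.2.2).
Proof.
rewrite sum_pair exchange_big; apply: eq_bigr => y _ /=.
under [RHS]eq_bigr => x _ do rewrite sum_pair exchange_big /=.
rewrite [RHS]exchange_big; apply: eq_bigr => b _ /=.
rewrite /omega_map mulr_suml; apply: eq_bigr => x _.
by rewrite mulr_suml; apply: eq_bigr => a _; rewrite mulrA.
Qed.

(** After dilating both contractions to isometries, the matrix is a submatrix of the one attached to
    a direct sum with a single summand. *)
Lemma opnorm_locmx_le_loc n (u : 'I_n -> 'I_n -> X * Y -> A * B -> C) s t
    (U : A -> X -> 'I_s -> C) (V : B -> Y -> 'I_t -> C) :
  (0 < #|A|)%N -> (0 < #|B|)%N ->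
  sqbounded (fun (p : A * 'I_s) x => U p.1 x p.2) 1 ->
  sqbounded (fun (p : B * 'I_t) y => V p.1 y p.2) 1 ->
  (opnorm (locmx u U V) <= loc_norm u)%E.
Proof.
move=> A0 B0 U1 V1.
have [s' [U' [isoU UU']]] := contraction_dilation A0 U1.
have [t' [V' [isoV VV']]] := contraction_dilation B0 V1.
apply: (@le_trans _ _ (@phiW_norm R X Y A B 1 (fun _ => s + s')%N
    (fun _ => t + t')%N (fun _ => U') (fun _ => V') n u)); last first.
  by apply: ereal_sup_ubound; do 5 eexists; split; last split; last reflexivity.
apply: le_opnorm => c c0; apply: (@sqbounded_sub _ _ _ _ _
  (fun p => (p.1, existT (fun _ : 'I_1 => 'I_(s + s') * 'I_(t + t'))%type ord0
     (lshift s' p.2.1, lshift t' p.2.2)))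
  (fun j => (j, ord0))) => //.
- move=> [i [k l]] [i' [k' l']] e.
  have /= -> := congr1 (fun p => p.1) e.
  have /= [kk ll] := congr1
    (fun p : 'I_n * {l : 'I_1 & ('I_(s + s') * 'I_(t + t'))%type} => projT2 p.2) e.
  by congr (_, (_, _)); apply: val_inj.
- by move=> j j' [].
move=> [i [k l]] j; rewrite locmxE /=.
by apply: eq_bigr => xy _; apply: eq_bigr => ab _; rewrite /Wentry /= UU' VV'.
Qed.

Definition row_map s (U : A -> X -> 'I_s -> C) (f : nat -> C) : A -> X -> C :=
  fun a x => \sum_(k < s) f k * U a x k.

Lemma compl_contr_row_map s (U : A -> X -> 'I_s -> C) :
  sqbounded (fun (p : A * 'I_s) x => U p.1 x p.2) 1 ->
  compl_contr_R_M (row_map U).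
Proof.
move=> U1; split=> [c g h _ _|m x _ x1].
  apply/funext => a; apply/funext => z; rewrite /row_map mulr_sumr -big_split /=.
  by apply: eq_bigr => k _; rewrite mulrDl mulrA.
have x1' : sqbounded (fun i (q : 'I_m * 'I_s) => x i q.1 q.2) 1.
  by apply/opnorm_le1P; apply: le_trans x1; apply: ereal_sup_ubound; exists s.
by apply/opnorm_le1P => v; have := sqbounded_slice x1' U1 v.
Qed.

Definition col_map t (V : B -> Y -> 'I_t -> C) (S : Y -> B -> C) : nat -> C :=
  fun k => \sum_y \sum_b S y b * oapp (V b y) 0 (insub k).

(** The norm of [S_1^{B,Y}] is defined by pairing with contractive matrices over [M_{B,Y}]; stacking
    the coordinates of [V] in one block column gives such a matrix, and the pairing with it contains
    the column to be bounded. *)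
Lemma compl_contr_col_map t (V : B -> Y -> 'I_t -> C) :
  sqbounded (fun (p : B * 'I_t) y => V p.1 y p.2) 1 ->
  compl_contr_S1_C (col_map V).
Proof.
move=> V1; split=> [S|].
  apply: (@l2_finsupp _ t) => k tk; rewrite /col_map insubN -?leqNgt //=.
  by apply: big1 => y _; apply: big1 => b _; rewrite mulr0.
split=> [c S S'|m v v1].
  apply/funext => k; rewrite /col_map mulr_sumr -big_split /=.
  apply: eq_bigr => y _; rewrite mulr_sumr -big_split /=.
  by apply: eq_bigr => b _; rewrite mulrDl mulrA.
apply: ub_ereal_sup => _ [K ->]; apply/opnorm_le1P.
case: K => [|K].
  by move=> v'; rewrite [leLHS]big1 ?mulr_ge0 ?vnorm2_ge0 // => -[i []].
pose w (p q : 'I_K.+1) b y := if q == ord0 then oapp (V b y) 0 (insub (p : nat)) else 0.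
have w1 : (mnorm_M w <= 1)%E.
  apply/opnorm_le1P.
  apply: (@sqbounded_pad _ _ _ _ _
    (fun p : 'I_K.+1 * B => omap (pair p.2) (insub (p.1 : nat)))
    (fun q : 'I_K.+1 * Y => if q.1 == ord0 then Some q.2 else None) _ _ _ _ _ _ _ V1) => //.
  - move=> [i b] [j b'] /=; case: insubP => [k _ ki|//]; case: insubP => [l _ lj|//] /=.
    by move=> [-> kl] _; congr (_, _); apply: val_inj; rewrite /= -ki -lj kl.
  - move=> [i k] [j l] /=; have [->|//] := eqVneq i ord0.
    by have [->|//] := eqVneq j ord0; case=> ->.
  - by move=> [p b] [q y]; rewrite /w /=; case: insubP => [k _ _|_] //=; case: ifP.
have /opnorm_le1P : (opnorm (fun (p q : 'I_K.+1 * 'I_m) =>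
    trpair (v p.2 q.2) (w p.1 q.1)) <= 1)%E.
  by apply: le_trans v1; apply: ereal_sup_ubound; exists K.+1, w.
apply: (@sqbounded_sub _ _ _ _ _ (fun p => (p.2, p.1)) (fun j => (ord0, j))) => //.
- by move=> [i k] [j l] [-> ->].
- by move=> i j [].
Qed.

(** With [row_map U] and [col_map V] as the two complete contractions, evaluation on the basis
    column displays [locmx] as a submatrix. *)
Lemma opnorm_locmx_le_wcb n (u : 'I_n -> 'I_n -> X * Y -> A * B -> C) s t
    (U : A -> X -> 'I_s -> C) (V : B -> Y -> 'I_t -> C) :
  sqbounded (fun (p : A * 'I_s) x => U p.1 x p.2) 1 ->
  sqbounded (fun (p : B * 'I_t) y => V p.1 y p.2) 1 ->
  (opnorm (locmx u U V) <= wcb_norm u)%E.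
Proof.
move=> U1 V1.
pose Phi f i j := col_map V (omega_map u (row_map U f) i j).
apply: (@le_trans _ _ (cbnorm_R_MnC Phi)); last first.
  apply: ereal_sup_ubound; exists (row_map U), (col_map V); split=> //.
    exact: compl_contr_row_map.
  by split=> //; apply: compl_contr_col_map.
(* Size [s.+1] provides a column [ord0] even when [s] is zero; the extra row is dropped by
   [widen_ord] below. *)
apply: (@le_trans _ _ (colnorm (fun p q : 'I_s.+1 * 'I_n =>
    Phi (basis_column p.1 q.1) p.2 q.2))); last first.
  apply: ereal_sup_ubound; exists s.+1, (@basis_column s).
  by split; [exact: l2_basis_column|split=> //; exact: rownorm_basis_column].
apply: (@le_trans _ _ (opnorm (fun (p : 'I_s.+1 * 'I_n * 'I_t) (q : 'I_s.+1 * 'I_n) =>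
    Phi (basis_column p.1.1 q.1) p.1.2 q.2 p.2))); last first.
  by apply: ereal_sup_ubound; exists t.
apply: le_opnorm => c c0; apply: (@sqbounded_sub _ _ _ _ _
  (fun p => ((widen_ord (leqnSn s) p.2.1, p.1), p.2.2)) (fun j => (ord0, j))) => //.
- by move=> [i [k l]] [i' [k' l']] [kk -> ->]; congr (_, (_, _)); apply: val_inj.
- by move=> j j' [].
move=> [i [k l]] j; rewrite /Phi /col_map /locmx /=.
apply: eq_bigr => y _; apply: eq_bigr => b _; rewrite valK /=; congr (_ * _).
apply: eq_bigr => x _; apply: eq_bigr => a _; congr (_ * _).
rewrite /row_map (bigD1 k) //= /basis_column !eqxx mul1r big1 ?addr0 // => k' kk'.
by rewrite /= eq_sym (inj_eq val_inj) (negbTE kk') mul0r.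
Qed.

End LocalTensors.

(** * Coordinates of complete contractions out of [R] and into [C] *)

Section CompletelyContractive.
Variable R : realType.
Local Notation C := (R[i]).

Lemma sqbounded_entry (I J : finType) (M : I -> J -> C) c i j :
  sqbounded M c -> cabs2 (M i j) <= c.
Proof.
move=> /(_ (fun k => (k == j)%:R)); rewrite {2}/vnorm2 (bigD1 j) //= big1 => [|k /negbTE ->].
  rewrite eqxx /cabs2 /= expr1n expr0n !addr0 mulr1; apply: le_trans.
  rewrite /vnorm2 (bigD1 i) //= {1}/mvmul (bigD1 j) //= eqxx mulr1 big1 ?addr0.
    by rewrite lerDl sumr_ge0 // => k _; apply: cabs2_ge0.
  by move=> k /negbTE ->; rewrite mulr0.
exact: cabs20.
Qed.

Lemma sqbounded_le (I J : finType) (M : I -> J -> C) c c' :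
  c <= c' -> sqbounded M c -> sqbounded M c'.
Proof.
by move=> cc Mc v; apply: le_trans (Mc v) _; rewrite ler_wpM2r ?vnorm2_ge0.
Qed.

Lemma sqbounded_norows (I J : finType) (M : I -> J -> C) c :
  (I -> False) -> 0 <= c -> sqbounded M c.
Proof.
move=> I0 c0 v; rewrite [leLHS]big1 ?mulr_ge0 ?vnorm2_ge0 // => i.
Qed.

Definition unit_seq (k : nat) : nat -> C := fun j => (k == j)%:R.
Definition trunc N (f : nat -> C) : nat -> C := fun k => if (k < N)%N then f k else 0.
Definition tail N (f : nat -> C) : nat -> C := fun k => if (k < N)%N then 0 else f k.

Lemma l2_trunc N f : l2 (trunc N f).
Proof. by apply: (@l2_finsupp _ _ N) => k; rewrite /trunc leqNgt => /negbTE ->. Qed.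

Lemma l2_unit_seq k : l2 (unit_seq k).
Proof.
by apply: (@l2_finsupp _ _ k.+1) => j kj; rewrite /unit_seq ltn_eqF.
Qed.

Lemma l2_tail N f : l2 f -> l2 (tail N f).
Proof.
move=> [M fM]; exists M => K; apply: le_trans (fM K); apply: ler_sum => k _.
by rewrite /tail; case: ifP => // _; rewrite cabs20 cabs2_ge0.
Qed.

(** Once a partial sum is within [e] of the supremum, later terms cannot add more than [e]. *)
Lemma small_tail (g : nat -> R) (M e : R) : (forall k, 0 <= g k) ->
  (forall N, \sum_(k < N) g k <= M) -> 0 < e ->
  exists N, forall K, \sum_(k < K) (if (k < N)%N then 0 else g k) <= e.
Proof.
move=> g0 gM e0; pose E := range (fun N => \sum_(k < N) g k).
have supE : has_sup E.
  by split; [exists (\sum_(k < 0) g k), 0%N|exists M => _ [N _ <-]].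
have [_ [N _ <-] Ne] := sup_adherent e0 supE.
exists N => K.
have up : \sum_(k < N + K) g k <= sup E.
  by apply: ub_le_sup; [exact: supE.2|exists (N + K)%N].
rewrite big_split_ord /= in up.
have : \sum_(k < K) (if (k < N)%N then 0 else g k) <= \sum_(k < K) g (N + k)%N.
  (* Splitting one sum of length [N + K] in both orders avoids comparing [K] with [N]. *)
  have h (F : nat -> R) : \sum_(k < N + K) F k = \sum_(k < K + N) F k by rewrite addnC.
  have := h (fun k => if (k < N)%N then 0 else g k); rewrite !big_split_ord /=.
  rewrite big1 ?add0r; last by move=> k _; rewrite ltn_ord.
  under eq_bigr => k _ do rewrite ltnNge leq_addr /=.
  by move=> ->; rewrite lerDl sumr_ge0 // => k _; case: ifP.
by lra.
Qed.

Section Alpha.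
Variables (A X : finType) (alpha : (nat -> C) -> A -> X -> C).
Hypothesis alphacc : compl_contr_R_M alpha.

Lemma alpha0 a x : alpha (fun _ => 0) a x = 0.
Proof.
have l20 : l2 (fun _ => 0 : C) by apply: (@l2_finsupp _ _ 0).
have := alphacc.1 1 _ _ l20 l20.
under eq_fun => k do rewrite mulr0 addr0.
move=> /(congr1 (fun f => f a x)) /eqP; rewrite mul1r -subr_eq subrr eq_sym.
by move=> /eqP.
Qed.

Lemma alpha_trunc N f a x :
  alpha (trunc N f) a x = \sum_(k < N) f k * alpha (unit_seq k) a x.
Proof.
elim: N => [|N IH]; first by rewrite big_ord0 -[RHS](alpha0 a x).
rewrite big_ord_recr /= -IH addrC.
have <- : (fun k => f N * unit_seq N k + trunc N f k) = trunc N.+1 f.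
  apply/funext => k; rewrite /trunc /unit_seq ltnS.
  case: (ltngtP k N) => [||->] /=; rewrite ?mulr0 ?mulr1 ?add0r ?addr0 //.
by rewrite alphacc.1 //; [exact: l2_unit_seq|exact: l2_trunc].
Qed.

Lemma alpha_split N f a x : l2 f ->
  alpha f a x = alpha (trunc N f) a x + alpha (tail N f) a x.
Proof.
move=> f2; have := alphacc.1 1 _ _ (l2_trunc N f) (l2_tail N f2).
under eq_fun => k.
  have -> : 1 * trunc N f k + tail N f k = f k.
    by rewrite mul1r /trunc /tail; case: ifP; rewrite ?addr0 ?add0r.
  over.
by move=> ->; rewrite mul1r.
Qed.

(** Rescaled by the inverse square root of [e], the sequence is a contractive 1 by 1 matrix over
    [R]. This controls [alpha] on tails, where no finite expansion is available. *)
Lemma alpha_bounded (f : nat -> C) e a x : 0 < e ->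
  (forall K, \sum_(k < K) cabs2 (f k) <= e) -> cabs2 (alpha f a x) <= e.
Proof.
move=> e0 fe.
pose c : C := ((Num.sqrt e)^-1)%:C%C.
have c2 : cabs2 c = e^-1.
  by rewrite /cabs2 /= expr0n addr0 exprVn sqr_sqrtr ?ltW.
have l2f : l2 f by exists e.
have l20 : l2 (fun _ => 0 : C) by apply: (@l2_finsupp _ _ 0).
have gE : alpha (fun k => c * f k) a x = c * alpha f a x.
  have := alphacc.1 c _ _ l2f l20.
  by under eq_fun => k do rewrite addr0; move=> ->; rewrite alpha0 addr0.
have l2g : l2 (fun k => c * f k).
  exists (cabs2 c * e) => K; under eq_bigr => k _ do rewrite cabs2M.
  by rewrite -mulr_sumr ler_wpM2l ?cabs2_ge0.
pose y (i j : 'I_1) k := c * f k.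
have y1 : (rownorm y <= 1)%E.
  apply: ub_ereal_sup => _ [K ->]; apply/opnorm_le1P.
  apply: sqbounded_le (sqbounded_frobenius _).
  rewrite big_ord1 vnorm2_pair big_ord1 vnorm2Z c2 mulrC ler_pdivrMr // mul1r.
  exact: fe.
have /opnorm_le1P/sqbounded_entry := alphacc.2 _ _ (fun _ _ => l2g) y1.
move=> /(_ (ord0, a) (ord0, x)); rewrite /= gE cabs2M c2 mulrC.
by rewrite ler_pdivrMr // mul1r.
Qed.

(** The passage from [alpha] to a contraction [U]: apply [alpha] to the basis column and read off
    the first block column. *)
Lemma alpha_column N :
  sqbounded (fun (p : A * 'I_N) x => alpha (unit_seq p.2) p.1 x) 1.
Proof.
case: N => [|N]; first by apply: sqbounded_norows => // -[_ []].
have /opnorm_le1P := alphacc.2 _ _ (@l2_basis_column R N) (rownorm_basis_column R N).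
apply: (@sqbounded_sub _ _ _ _ _ (fun p => (p.2, p.1)) (fun x => (ord0, x))) => //.
- by move=> [i k] [j l] [-> ->].
- by move=> i j [].
Qed.

End Alpha.

Section Beta.
Variables (B Y : finType) (beta : (Y -> B -> C) -> nat -> C).
Hypothesis betacc : compl_contr_S1_C beta.

Definition unit_S1 b0 y0 : Y -> B -> C := fun y b => ((b0 == b) && (y0 == y))%:R.

Lemma beta_lincomb (I : eqType) (s : seq I) (c : I -> C) (F : I -> Y -> B -> C) k :
  beta (fun y b => \sum_(i <- s) c i * F i y b) k =
  \sum_(i <- s) c i * beta (F i) k.
Proof.
elim: s => [|i s IH].
  rewrite big_nil; under eq_fun => y do under eq_fun => b do rewrite big_nil.
  have := betacc.2.1 1 (fun _ _ => 0) (fun _ _ => 0).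
  under eq_fun => y do under eq_fun => b do rewrite mulr0 addr0.
  move=> /(congr1 (fun f => f k)) /eqP; rewrite mul1r -subr_eq subrr eq_sym.
  by move=> /eqP.
rewrite big_cons; under eq_fun => y do under eq_fun => b do rewrite big_cons.
by rewrite betacc.2.1 IH.
Qed.

Lemma betaE S k : beta S k = \sum_y \sum_b S y b * beta (unit_S1 b y) k.
Proof.
rewrite pair_bigA /= -(@beta_lincomb _ _ (fun p => S p.1 p.2) (fun p => unit_S1 p.2 p.1)).
congr (beta _ k); apply/funext => y; apply/funext => b.
rewrite (bigD1 (y, b)) //= /unit_S1 !eqxx mulr1 big1 ?addr0 // => -[y' b'].
by rewrite xpair_eqE andbC => /negbTE ->; rewrite mulr0.
Qed.

(* The blocks [unit_S1 b y], placed in position (b, y), represent the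
   identity map of [M_{B,Y}], so they form a matrix of norm one over
   [S_1^{B,Y}]. *)
Lemma beta_column K :
  sqbounded (fun (p : B * 'I_K) y => beta (unit_S1 p.1 y) p.2) 1.
Proof.
(* The matrix has to be square, so rows and columns are both indexed by [B + Y]; only the corner
   with rows in [B] and columns in [Y] is nonzero. *)
pose m := #|{: B + Y}|.
pose w (i j : 'I_m) y b : C := ((enum_val i == inl b) && (enum_val j == inr y))%:R.
have w1 : (mnorm_S1 w <= 1)%E.
  apply: ub_ereal_sup => _ [m' [t [/opnorm_le1P t1 ->]]]; apply/opnorm_le1P.
  apply: (@sqbounded_pad _ _ _ _ _
    (fun p : 'I_m' * 'I_m => if enum_val p.2 is inl b then Some (p.1, b) else None)
    (fun q : 'I_m' * 'I_m => if enum_val q.2 is inr y then Some (q.1, y) else None)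
    _ _ _ _ _ _ _ t1) => //.
  - move=> [p i] [q j] /=; case Ei : (enum_val i) => [b|//]; case Ej : (enum_val j) => [b'|//].
    by move=> [-> bb] _; congr (_, _); apply: enum_val_inj; rewrite Ei Ej bb.
  - move=> [p i] [q j] /=; case Ei : (enum_val i) => [//|y]; case Ej : (enum_val j) => [//|y'].
    by move=> [-> bb] _; congr (_, _); apply: enum_val_inj; rewrite Ei Ej bb.
  move=> [p i] [q j]; rewrite /trpair /w /=.
  case: (enum_val i) => [b|y'].
    case: (enum_val j) => [b'|y].
      by apply: big1 => y _; apply: big1 => b'' _; rewrite andbF mul0r.
    rewrite (bigD1 y) //= (bigD1 b) //= !eqxx mul1r big1 ?addr0; last first.
      by move=> b' b'b; rewrite [inl b == _]eq_sym (_ : _ == _ = false) ?mul0r; last exact/negbTE.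
    rewrite big1 ?addr0 // => y' y'y; apply: big1 => b' _.
    by rewrite [inr y == _]eq_sym (_ : inr y' == _ = false) ?andbF ?mul0r; last exact/negbTE.
  by apply: big1 => y _; apply: big1 => b'' _; rewrite mul0r.
have /opnorm_le1P : (opnorm (fun (p : 'I_m * 'I_K) j => beta (w p.1 j) p.2) <= 1)%E.
  by apply: le_trans (betacc.2.2 _ _ w1); apply: ereal_sup_ubound; exists K.
apply: (@sqbounded_sub _ _ _ _ _ (fun p => (enum_rank (inl p.1), p.2))
  (fun y => enum_rank (inr y))) => //.
- by move=> [b k] [b' k'] [/enum_rank_inj [->] ->].
- by move=> y y' /enum_rank_inj [].
move=> [b k] y; congr (beta _ k); apply/funext => y'; apply/funext => b'.
by rewrite /w /unit_S1 !enum_rankK.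
Qed.

End Beta.

End CompletelyContractive.

(** * The two inequalities *)

Section Comparison.
Variables (R : realType) (X Y A B : finType).
Local Notation C := (R[i]).

Lemma loc_norm_ge0 n (u : 'I_n -> 'I_n -> X * Y -> A * B -> C) :
  (0 <= loc_norm u)%E.
Proof.
(* The empty direct sum is admissible without exhibiting any isometry. *)
apply: (@le_trans _ _ (phiW_norm (fun l : 'I_0 => fun _ _ (_ : 'I_0) => 0 : C)
  (fun l : 'I_0 => fun _ _ (_ : 'I_0) => 0 : C) u)); first exact: opnorm_ge0.
by apply: ereal_sup_ubound; do 5 eexists; split; last split; last reflexivity; case.
Qed.

Lemma wcb_norm_ge0 n (u : 'I_n -> 'I_n -> X * Y -> A * B -> C) :
  (0 <= wcb_norm u)%E.
Proof.
apply: (le_trans (opnorm_ge0 (locmx u (fun _ _ (_ : 'I_0) => 0) (fun _ _ (_ : 'I_0) => 0)))).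
by apply: opnorm_locmx_le_wcb; apply: sqbounded_norows => // -[_ []].
Qed.

Lemma loc_le_wcb n (u : 'I_n -> 'I_n -> X * Y -> A * B -> C) :
  (loc_norm u <= wcb_norm u)%E.
Proof.
have := wcb_norm_ge0 u; case E : (wcb_norm u) => [L||] //=; last by move=> _; rewrite leey.
rewrite lee_fin => L0.
apply: ub_ereal_sup => _ [N [s [t [U [V [isoU [isoV ->]]]]]]].
apply/opnorm_leP => //.
(* Each block of the direct sum is a [locmx], so a common bound on the blocks suffices. *)
pose phi l i (k : 'I_(s l) * 'I_(t l)) j := locmx u (U l) (V l) (i, k) j.
apply: eq_sqbounded (@sqbounded_blockdiag _ _ _ _ _ phi (L ^+ 2) _) => [[i k] [j l]|l].
  rewrite /Wentry /=; case: ifP => _; first by rewrite /phi locmxE.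
  by rewrite big1 // => xy _; rewrite big1 // => ab _; rewrite mulr0.
have : (opnorm (locmx u (U l) (V l)) <= L%:E)%E.
  by rewrite -E; apply: opnorm_locmx_le_wcb; apply: isometry_sqbounded.
by move=> /opnorm_leP => /(_ L0); apply: eq_sqbounded => -[].
Qed.

Lemma le_of_approx (a b c : R) : 0 <= b -> 0 <= c ->
  (forall d e, 0 < d -> 0 < e -> a <= (1 + d) * b + (1 + d^-1) * (c * e)) -> a <= b.
Proof.
move=> b0 c0 H; apply/ler_addgt0Pr => eps eps0.
(* First [d], then [e] depending on [d], make each error at most [eps / 2]; the added ones keep the
   denominators positive. *)
pose d := eps / (2 * (b + 1)).
have d0 : 0 < d by rewrite divr_gt0 // mulr_gt0 // ltr_wpDl.
have dV0 : 0 < 1 + d^-1 by rewrite addr_gt0 // invr_gt0.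
pose e := eps / (2 * (c + 1) * (1 + d^-1)).
have e0 : 0 < e by rewrite divr_gt0 // !mulr_gt0 // ltr_wpDl.
apply: le_trans (H d e d0 e0) _.
have -> : (1 + d^-1) * (c * e) = eps / 2 * (c / (c + 1)).
  by rewrite /e; field; apply/and3P; split; apply: lt0r_neq0; lra.
have -> : (1 + d) * b = b + eps / 2 * (b / (b + 1)).
  by rewrite /d; field; apply: lt0r_neq0; rewrite ltr_wpDl.
have h z : 0 <= z -> eps / 2 * (z / (z + 1)) <= eps / 2.
  move=> z0; rewrite ler_piMr ?divr_ge0 ?(ltW eps0) //.
  by rewrite ler_pdivrMr ?ltr_wpDl // mul1r lerDl.
by have := h _ b0; have := h _ c0; lra.
Qed.

(** The second tensor factor is paired off first, which leaves coefficients for the values of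
    [alpha]. *)
Definition contracted n (u : 'I_n -> 'I_n -> X * Y -> A * B -> C)
    (V : B -> Y -> C) i j (p : A * X) : C :=
  \sum_y \sum_b u i j (p.2, y) (p.1, b) * V b y.

Lemma contractedE n (u : 'I_n -> 'I_n -> X * Y -> A * B -> C) V i j T :
  \sum_y \sum_b omega_map u T i j y b * V b y =
  \sum_p contracted u V i j p * T p.1 p.2.
Proof.
rewrite sum_pair [RHS]exchange_big /= /contracted.
under [RHS]eq_bigr => x _ do under eq_bigr => a _ do rewrite mulr_suml.
under [RHS]eq_bigr => x _ do rewrite exchange_big /=.
rewrite [RHS]exchange_big; apply: eq_bigr => y _ /=.
under [RHS]eq_bigr => x _ do under eq_bigr => a _ do rewrite mulr_suml.
under [RHS]eq_bigr => x _ do rewrite exchange_big /=.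
rewrite [RHS]exchange_big; apply: eq_bigr => b _ /=.
rewrite /omega_map mulr_suml; apply: eq_bigr => x _.
by rewrite mulr_suml; apply: eq_bigr => a _; rewrite mulrAC.
Qed.

Lemma wcb_le_loc n (u : 'I_n -> 'I_n -> X * Y -> A * B -> C) :
  (0 < #|A|)%N -> (0 < #|B|)%N -> (wcb_norm u <= loc_norm u)%E.
Proof.
move=> A0 B0.
have := loc_norm_ge0 u; case E : (loc_norm u) => [L||] //=; last by move=> _; rewrite leey.
rewrite lee_fin => L0.
apply: ub_ereal_sup => _ [alpha [beta [alphacc [betacc ->]]]].
apply: ub_ereal_sup => _ [m [x [x2 [x1 ->]]]].
apply: ub_ereal_sup => _ [K ->]; apply/opnorm_leP => //.
pose V b y k := beta (unit_S1 R b y) k.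
pose D i j k := contracted u (fun b y => V b y k) i j.
pose M (f : 'I_m -> 'I_m -> nat -> C) (p : 'I_m * 'I_n * 'I_K) (q : 'I_m * 'I_n) : C :=
  \sum_r D p.1.2 q.2 p.2 r * alpha (f p.1.1 q.1) r.1 r.2.
have ME f (p : 'I_m * 'I_n * 'I_K) q : beta (omega_map u (alpha (f p.1.1 q.1)) p.1.2 q.2) p.2 = M f p q.
  by rewrite (betaE betacc) contractedE.
suff : sqbounded (M x) (L ^+ 2).
  by apply: eq_sqbounded => p q; rewrite ME.
(* On truncated sequences the matrix is the row [x] times a column of [locmx] entries, for the
   contractions read off from [alpha] and [beta]. *)
have truncM N : sqbounded (M (fun i j => trunc N (x i j))) (L ^+ 2).
  have xN : sqbounded (fun i (q : 'I_m * 'I_N) => x i q.1 q.2) 1.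
    by apply/opnorm_le1P; apply: le_trans x1; apply: ereal_sup_ubound; exists N.
  pose UN a z (k : 'I_N) := alpha (unit_seq R k) a z.
  pose VK b y (k : 'I_K) := V b y k.
  have phiL : sqbounded (fun (p : 'I_n * 'I_K * 'I_N) j =>
      locmx u UN VK (p.1.1, (p.2, p.1.2)) j) (L ^+ 2).
    have : (opnorm (locmx u UN VK) <= L%:E)%E.
      rewrite -E; apply: opnorm_locmx_le_loc => //.
        exact: alpha_column.
      exact: beta_column.
    move=> /opnorm_leP => /(_ L0).
    apply: (@sqbounded_sub _ _ _ _ _ (fun p => (p.1.1, (p.2, p.1.2))) id) => //.
      exact: sqr_ge0.
    by move=> [[i k] l] [[i' k'] l'] [-> -> ->].
  have := sqbounded_slice xN phiL.
  apply: (@sqbounded_sub _ _ _ _ _ (fun p => (p.1.1, (p.1.2, p.2))) id) => //.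
  - exact: sqr_ge0.
  - by move=> [[i k] l] [[i' k'] l'] [-> -> ->].
  move=> [[p i] k] [q j]; rewrite /M /=.
  under [RHS]eq_bigr => l _ do rewrite /locmx contractedE mulr_sumr.
  rewrite exchange_big; apply: eq_bigr => r _ /=.
  rewrite (alpha_trunc alphacc) mulr_sumr.
  by apply: eq_bigr => l _; rewrite mulrCA.
move=> v.
(* If all entries of [alpha] on the tails have squared modulus at most [e], then [c * e] bounds the
   squared Hilbert-Schmidt norm of the tail matrix. *)
pose c := \sum_(p : 'I_m * 'I_n * 'I_K) \sum_(q : 'I_m * 'I_n)
  vnorm2 (D p.1.2 q.2 p.2) * #|{: A * X}|%:R.
have c0 : 0 <= c.
  by do 2 apply: sumr_ge0 => ? _; rewrite mulr_ge0 ?vnorm2_ge0.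
apply: (@le_of_approx _ _ (c * vnorm2 v)); rewrite ?mulr_ge0 ?vnorm2_ge0 ?sqr_ge0 //.
move=> d e d0 e0.
have [N tailN] : exists N, forall i j K', \sum_(k < K') cabs2 (tail N (x i j) k) <= e.
  (* Summing over all entries of [x] yields one [N] for all of them. The default 0 of [xget] is
     never taken, since [l2] supplies a bound. *)
  pose g k := \sum_i \sum_j cabs2 (x i j k).
  have [] := @small_tail R g (\sum_i \sum_j xget 0 [set M0 | forall N, \sum_(k < N) cabs2 (x i j k) <= M0]%classic) e.
  - by move=> k; do 2 apply: sumr_ge0 => ? _; apply: cabs2_ge0.
  - move=> N; rewrite exchange_big; apply: ler_sum => i _ /=.
    rewrite exchange_big; apply: ler_sum => j _ /=.
    case: xgetP => [M0 _ /= h|h]; first exact: h.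
    by have [M0 hM0] := x2 i j; case: (h M0).
  - exact: e0.
  move=> N hN; exists N => i j K'; apply: le_trans (hN K').
  apply: ler_sum => k _; rewrite /tail; case: ifP => _; first by rewrite cabs20.
  rewrite /g (bigD1 i) //= (bigD1 j) //= -addrA lerDl addr_ge0 //.
    by apply: sumr_ge0 => ? _; apply: cabs2_ge0.
  by do 2 apply: sumr_ge0 => ? _; apply: cabs2_ge0.
rewrite (@eq_vnorm2 _ _ _ (fun p => mvmul (M (fun i j => trunc N (x i j))) v p
    + mvmul (M (fun i j => tail N (x i j))) v p)); last first.
  move=> p; rewrite /mvmul -big_split; apply: eq_bigr => q _ /=.
  rewrite -mulrDl; congr (_ * _); rewrite /M -big_split; apply: eq_bigr => r _ /=.
  by rewrite (alpha_split alphacc N) // mulrDr.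
apply: le_trans (vnorm2D_le _ _ d0) _.
apply: lerD; apply: ler_wpM2l; rewrite ?addr_ge0 ?invr_ge0 ?(ltW d0) //.
  exact: truncM.
apply: le_trans (sqbounded_frobenius _ _) _.
rewrite mulrAC ler_wpM2r ?vnorm2_ge0 // mulr_suml; apply: ler_sum => p _.
rewrite mulr_suml; apply: ler_sum => q _; apply: le_trans (cauchy_schwarz _ _) _.
rewrite -mulrA ler_wpM2l ?vnorm2_ge0 // mulr_natl -sumr_const.
by apply: ler_sum => r _; apply: (alpha_bounded alphacc).
Qed.

End Comparison.

(* The identity map eps_{(x,y),(a,b)} <-> eps_{x,a} (x) eps_{y,b} is a   *)
(* complete isometry O^{R_loc}_{XY,AB} -> S_1^{A,X} (x)_{w,cb} S_1^{B,Y}: *)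
(* all matricial norms agree.                                            *)
Theorem theorem5p4 (R : realType) (X Y A B : finType) :
  (0 < #|X|)%N -> (0 < #|Y|)%N -> (0 < #|A|)%N -> (0 < #|B|)%N ->
  forall (n : nat) (u : 'I_n -> 'I_n -> (X * Y)%type -> (A * B)%type -> R[i]),
    loc_norm u = wcb_norm u.
Proof.
move=> _ _ A0 B0 n u; apply/eqP.
by rewrite eq_le loc_le_wcb wcb_le_loc.
Qed.
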